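(* Assume that (1) $f:\mathbb{R}^n\to\mathbb{R}^n$ is $\beta$-strongly monotone and $L$-Lipschitz continuous; (2) $\Phi(x)=s(x)+\Omega$ for every $x\in\mathbb{R}^n$, where $s:\mathbb{R}^n\to\mathbb{R}^n$ is Lipschitz continuous with Lipschitz constant $l>0$ and $\Omega$ is a nonempty, closed and convex subset of $\mathbb{R}^n$; (3) $\beta>l$ and $\alpha>\dfrac{L^2+l^2}{2(\beta-l)}$; (4) $(\lambda_k)_{k\in\mathbb{N}}$ is a sequence of real numbers and $A,B$ are constants such that, for every $k\in\mathbb{N}$, $$0<A<\lambda_k<B,\qquad\text{where}\qquad 0<\frac{B^2}{A}<\frac{2\alpha(\beta-l)-(L^2+l^2)}{\alpha^2(\beta-l)}.$$ Then, for any initial point $x_0\in\mathbb{R}^n$, the sequence $\{x_k\}$ generated by $$x_{k+1}=x_k+\lambda_k\left\{P_{\Phi(x_k)}\big(f(x_k)-\alpha x_k\big)-f(x_k)\right\},\qquad k\in\mathbb{N},$$ converges strongly (i.e. in norm) to the unique solution of the inverse quasi-variational inequality problem: find $x^*\in\mathbb{R}^n$ such that $f(x^* )\in\Phi(x^* )$ and $\langle x^*,y-f(x^* )\rangle\ge0$ for all $y\in\Phi(x^* )$.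
   Context: $\mathbb{R}^n$ carries the usual Euclidean inner product $\langle\cdot,\cdot\rangle$ and norm $\|\cdot\|$; $\mathbb{N}=\{0,1,2,\dots\}$. For a nonempty closed convex set $C\subset\mathbb{R}^n$, $P_C(x)=\arg\min_{y\in C}\|x-y\|$ is the nearest point projection onto $C$. A map $g:\mathbb{R}^n\to\mathbb{R}^n$ is Lipschitz continuous with constant $M$ if $\|g(x)-g(y)\|\le M\|x-y\|$ for all $x,y$; it is $\beta$-strongly monotone (with $\beta>0$) if $\langle g(x)-g(y),x-y\rangle\ge\beta\|x-y\|^2$ for all $x,y$. The notation $s(x)+\Omega$ means $\{s(x)+\omega:\omega\in\Omega\}$. *)

(* Defs.v *)
From HB Require Import structures.
From mathcomp Require Import all_boot all_order all_algebra.
From mathcomp Require Import all_classical all_reals all_analysis.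
Set Implicit Arguments.
Unset Strict Implicit.
Unset Printing Implicit Defensive.
Import Order.TTheory GRing.Theory Num.Theory.
Import numFieldNormedType.Exports.
Local Open Scope classical_set_scope.
Local Open Scope ring_scope.

(* R^n is 'rV[R]_n.  The library norm `|x| on 'rV[R]_n is the sup norm, so the
   Euclidean structure is defined here; the library topology on 'rV[R]_n (used
   for closed) is the product topology, i.e. the Euclidean one. *)
Definition edot (R : realType) (n : nat) (x y : 'rV[R]_n) : R :=
  \sum_(i < n) x 0 i * y 0 i.

Definition enorm (R : realType) (n : nat) (x : 'rV[R]_n) : R :=
  Num.sqrt (edot x x).

Definition elipschitz (R : realType) (n : nat) (M : R)
    (g : 'rV[R]_n -> 'rV[R]_n) : Prop :=
  forall x y, enorm (g x - g y) <= M * enorm (x - y).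

Definition strongly_monotone (R : realType) (n : nat) (beta : R)
    (g : 'rV[R]_n -> 'rV[R]_n) : Prop :=
  0 < beta /\
  forall x y, beta * enorm (x - y) ^+ 2 <= edot (g x - g y) (x - y).

Definition nearest_points (R : realType) (n : nat) (C : set 'rV[R]_n)
    (x : 'rV[R]_n) : set 'rV[R]_n :=
  [set p | C p /\ forall y, C y -> enorm (x - p) <= enorm (x - y)].

(* The value 0 is a default, taken only when C has no point nearest to x; this
   does not happen when C is nonempty, closed and convex. *)
Definition metric_proj (R : realType) (n : nat) (C : set 'rV[R]_n)
    (x : 'rV[R]_n) : 'rV[R]_n :=
  xget 0 (nearest_points C x).

Definition iqvi_solution (R : realType) (n : nat)
    (f : 'rV[R]_n -> 'rV[R]_n) (Phi : 'rV[R]_n -> set 'rV[R]_n)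
    (x : 'rV[R]_n) : Prop :=
  Phi x (f x) /\ forall y, Phi x y -> 0 <= edot x (y - f x).

(* Main.v *)
(* With h = f - s, the projection onto s(x) + Omega is the projection P onto Omega
   shifted by s(x), so the iteration reads x + lambda (P(h(x) - alpha x) - h(x)).  Firm
   nonexpansiveness of P and Young's inequality show that all these steps, for
   A < lambda < B, contract Euclidean distances by one common factor < 1, as soon as
   B < 2/alpha - (L^2 + l^2)/(alpha^2 (beta - l)); this holds because B < B^2/A, and
   L^2 + l^2 comes from |h(x) - h(y)|^2 <= 2 (L^2 + l^2) |x - y|^2.  A zero of the bracket
   is fixed by every step and solves the problem; strong monotonicity of h makes the
   solution unique. *)
Require Import Defs.
From HB Require Import structures.
From mathcomp Require Import all_boot all_order all_algebra.
From mathcomp Require Import all_classical all_reals all_analysis.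
From mathcomp Require Import ring lra.
Set Implicit Arguments.
Unset Strict Implicit.
Unset Printing Implicit Defensive.
Import Order.TTheory GRing.Theory Num.Theory.
Import numFieldNormedType.Exports.
Local Open Scope classical_set_scope.
Local Open Scope ring_scope.

(** * Euclidean inner product and norm *)

Lemma edotC (R : realType) (n : nat) (x y : 'rV[R]_n) : edot x y = edot y x.
Proof. by apply: eq_bigr => i _; rewrite mulrC. Qed.

Lemma edotDl (R : realType) (n : nat) (x y z : 'rV[R]_n) :
  edot (x + y) z = edot x z + edot y z.
Proof. by rewrite -big_split; apply: eq_bigr => i _; rewrite mxE mulrDl. Qed.

Lemma edotZl (R : realType) (n : nat) (a : R) (x y : 'rV[R]_n) :
  edot (a *: x) y = a * edot x y.
Proof. by rewrite /edot mulr_sumr; apply: eq_bigr => i _; rewrite mxE mulrA. Qed.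

Lemma edotNl (R : realType) (n : nat) (x y : 'rV[R]_n) :
  edot (- x) y = - edot x y.
Proof. by rewrite -scaleN1r edotZl mulN1r. Qed.

Lemma edotDr (R : realType) (n : nat) (x y z : 'rV[R]_n) :
  edot x (y + z) = edot x y + edot x z.
Proof. by rewrite edotC edotDl !(edotC x). Qed.

Lemma edotZr (R : realType) (n : nat) (a : R) (x y : 'rV[R]_n) :
  edot x (a *: y) = a * edot x y.
Proof. by rewrite edotC edotZl edotC. Qed.

Lemma edotNr (R : realType) (n : nat) (x y : 'rV[R]_n) :
  edot x (- y) = - edot x y.
Proof. by rewrite edotC edotNl edotC. Qed.

Definition edotE := (edotDl, edotDr, edotNl, edotNr, edotZl, edotZr).

Lemma edot_ge0 (R : realType) (n : nat) (x : 'rV[R]_n) : 0 <= edot x x.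
Proof. by apply: sumr_ge0 => i _; rewrite -expr2 sqr_ge0. Qed.

Lemma edot_eq0 (R : realType) (n : nat) (x : 'rV[R]_n) :
  edot x x = 0 -> x = 0.
Proof.
move=> /eqP; rewrite psumr_eq0; last by move=> i _; rewrite -expr2 sqr_ge0.
move=> /allP x0; apply/rowP => i; rewrite mxE; apply/eqP.
have := x0 i (mem_index_enum _); rewrite /= mulf_eq0 orbb; exact.
Qed.

Lemma enorm_ge0 (R : realType) (n : nat) (x : 'rV[R]_n) : 0 <= enorm x.
Proof. exact: sqrtr_ge0. Qed.

Lemma sqr_enorm (R : realType) (n : nat) (x : 'rV[R]_n) :
  enorm x ^+ 2 = edot x x.
Proof. by rewrite sqr_sqrtr ?edot_ge0. Qed.

Lemma enorm0 (R : realType) (n : nat) : enorm (0 : 'rV[R]_n) = 0.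
Proof. by rewrite /enorm -[0](scale0r 0) edotZl mul0r sqrtr0. Qed.

Lemma enorm_eq0 (R : realType) (n : nat) (x : 'rV[R]_n) :
  enorm x = 0 -> x = 0.
Proof. by move=> x0; apply: edot_eq0; rewrite -sqr_enorm x0 expr0n. Qed.

Lemma enormN (R : realType) (n : nat) (x : 'rV[R]_n) : enorm (- x) = enorm x.
Proof. by rewrite /enorm !edotE opprK. Qed.

(** Cauchy-Schwarz: the squared norm of [enorm y *: x - enorm x *: y] is
    [2 |x| |y| (|x| |y| - <x, y>)]; the factor [|x| |y|] is cancelled once the zero cases are set
    aside. *)
Lemma edot_le (R : realType) (n : nat) (x y : 'rV[R]_n) :
  edot x y <= enorm x * enorm y.
Proof.
have [x0|xN0] := eqVneq (enorm x) 0.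
  by rewrite x0 (enorm_eq0 x0) -[0](scale0r 0) edotZl !mul0r.
have [y0|yN0] := eqVneq (enorm y) 0.
  by rewrite y0 (enorm_eq0 y0) -[0](scale0r 0) edotZr mul0r mulr0.
have xy_gt0 : 0 < enorm x * enorm y.
  by rewrite mulr_gt0 // lt_def ?xN0 ?yN0 enorm_ge0.
have := edot_ge0 (enorm y *: x - enorm x *: y).
rewrite !edotE -!sqr_enorm (edotC y x) => H.
rewrite -(ler_pM2l xy_gt0); lra.
Qed.

Lemma enormD (R : realType) (n : nat) (x y : 'rV[R]_n) :
  enorm (x + y) <= enorm x + enorm y.
Proof.
rewrite -(@ler_pXn2r _ 2) ?nnegrE ?addr_ge0 ?enorm_ge0 // sqrrD !sqr_enorm.
by rewrite !edotE (edotC y x); have := edot_le x y; lra.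
Qed.

(** Transfers Euclidean bounds to the sup norm, in which boundedness and limits of vectors are
    expressed. *)
Lemma normr_le_enorm (R : realType) (n : nat) (x : 'rV[R]_n) :
  `|x| <= enorm x.
Proof.
rewrite /Num.norm /= mx_normrE; apply/bigmax_leP; split; first exact: enorm_ge0.
move=> [i j] _ /=; rewrite ord1 -sqrtr_sqr ler_wsqrtr // /edot (bigD1 j) //=.
by rewrite expr2 lerDl sumr_ge0 // => k _; rewrite -expr2 sqr_ge0.
Qed.

(** * Continuity of the Euclidean norm and of Lipschitz maps *)

Lemma enorm_continuous (R : realType) (n : nat) :
  continuous (@enorm R n).
Proof.
have edot_cont : continuous (fun z : 'rV[R]_n => edot z z).
  apply: continuous_big => [|i _ x]; first exact: add_continuous.
  have coordi : {for x, continuous (fun z : 'rV[R]_n => z 0 i)}.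
    exact: coord_continuous.
  exact: (cvgM coordi coordi).
move=> x; apply: continuous_comp; first exact: edot_cont.
exact: sqrt_continuous.
Qed.

Lemma enormB_continuous (R : realType) (n : nat) (x : 'rV[R]_n) :
  continuous (fun y : 'rV[R]_n => enorm (y - x)).
Proof.
move=> z.
have subx : y - x @[y --> z] --> z - x by exact: (cvgB cvg_id (cvg_cst x)).
exact: (cvg_comp _ _ subx (@enorm_continuous R n (z - x))).
Qed.

Lemma elipschitz_continuous (R : realType) (n : nat) (M : R)
    (g : 'rV[R]_n -> 'rV[R]_n) :
  elipschitz M g -> continuous g.
Proof.
move=> g_lip x.
have Mcvg : M * enorm (y - x) @[y --> x] --> M * enorm (x - x).
  exact: (cvgMl_tmp (@enormB_continuous R n x x)).
rewrite subrr enorm0 mulr0 in Mcvg.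
have gx_le y : 0 <= `|g y - g x| <= M * enorm (y - x).
  by rewrite normr_ge0 /= (le_trans (normr_le_enorm _)).
have : `|g y - g x| @[y --> x] --> (0 : R).
  exact: (squeeze_cvgr (nearW _ gx_le) (cvg_cst 0) Mcvg).
by move=> /norm_cvg0P /subr_cvg0.
Qed.

Lemma elipschitz_sqr (R : realType) (n : nat) (M : R)
    (g : 'rV[R]_n -> 'rV[R]_n) (x y : 'rV[R]_n) :
  elipschitz M g ->
  edot (g x - g y) (g x - g y) <= M ^+ 2 * edot (x - y) (x - y).
Proof.
move=> g_lip; rewrite -!sqr_enorm -exprMn lerXn2r ?nnegrE ?enorm_ge0 //.
exact: le_trans (enorm_ge0 _) (g_lip x y).
Qed.

(** * Minimisation of coercive functions: nearest points and fixed points *)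

(** Coercivity makes the part of [C] in a sublevel set of [phi] compact, so the extreme value
    theorem applies there. This serves both for nearest points and for fixed points of
    contractions. *)
Lemma coercive_min (R : realType) (n : nat) (C : set 'rV[R]_n)
    (phi : 'rV[R]_n -> R) :
  C !=set0 -> closed C -> continuous phi ->
  (forall c, exists M, forall y, phi y <= c -> enorm y <= M) ->
  exists2 p, C p & forall y, C y -> phi p <= phi y.
Proof.
move=> [y0 Cy0] C_closed phi_cont phi_coer.
have [M phiM] := phi_coer (phi y0).
pose K := C `&` [set y | phi y <= phi y0].
have K_closed : closed K.
  apply: closedI => //.
  by move/continuous_closedP: phi_cont => /(_ _ (@closed_le R (phi y0))).
have K_bounded : bounded_set K.
  exists M; split; first exact: num_real.
  move=> N MN y [_ /phiM yM] /=.
  exact: le_trans (normr_le_enorm y) (le_trans yM (ltW MN)).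
have K_neq0 : K !=set0 by exists y0; split => /=.
have phi_within : {within K, continuous phi} by exact: continuous_subspaceT.
have K_compact := bounded_closed_compact K_bounded K_closed.
have [p] := EVT_min_rV K_neq0 K_compact phi_within.
rewrite inE => -[Cp phip] pmin; exists p => // y Cy.
have [yle|/ltW] := leP (phi y) (phi y0); last exact: le_trans.
by apply: pmin; rewrite inE.
Qed.

Lemma nearest_points_nonempty (R : realType) (n : nat) (C : set 'rV[R]_n)
    (u : 'rV[R]_n) :
  C !=set0 -> closed C -> nearest_points C u !=set0.
Proof.
move=> C0 C_closed.
have [||p Cp pmin] := @coercive_min R n C (fun y => enorm (y - u)) C0 C_closed.
- exact: enormB_continuous.
- move=> c; exists (enorm u + c) => y yc.
  by have := enormD (y - u) u; rewrite subrK => /le_trans; apply; lra.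
by exists p; split=> // y Cy; rewrite -enormN opprB -(enormN (u - y)) opprB pmin.
Qed.

(** If the inner product [m] were positive, a short move from [p] towards [y] would stay in [C] and
    come closer to [u]. *)
Lemma nearest_points_edot_le0 (R : realType) (n : nat) (C : set 'rV[R]_n)
    (u p y : 'rV[R]_n) :
  convex_set C -> nearest_points C u p -> C y -> edot (u - p) (y - p) <= 0.
Proof.
move=> C_convex [Cp pmin] Cy; rewrite leNgt; apply/negP => m_gt0.
set m := edot _ _ in m_gt0; set b := edot (y - p) (y - p).
have b_ge0 : 0 <= b := edot_ge0 _.
have s_gt0 : 0 < m + b + 1 by lra.
(* Moving by [t] changes the squared distance by [t ^+ 2 * b - 2 * t * m], negative once
   [t * b < m]; [t <= 1] keeps the point in [C]. *)
pose t := m / (m + b + 1).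
have t_gt0 : 0 < t by rewrite divr_gt0.
have t_le1 : t <= 1 by rewrite ler_pdivrMr //; lra.
have tb : t * b < m.
  rewrite /t mulrAC ltr_pdivrMr // ; nra.
have Cz : C (p + t *: (y - p)).
  have -> : p + t *: (y - p) = t *: y + (1 - t) *: p.
    by rewrite scalerBr scalerBl scale1r addrCA.
  by have := C_convex y p (Itv01 (ltW t_gt0) t_le1); rewrite !inE; apply.
have := pmin _ Cz.
rewrite -(@ler_pXn2r _ 2) ?nnegrE ?enorm_ge0 // !sqr_enorm.
have -> : u - (p + t *: (y - p)) = (u - p) - t *: (y - p) by rewrite opprD addrA.
have -> v w : edot (v - t *: w) (v - t *: w) =
    edot v v - 2 * t * edot v w + t ^+ 2 * edot w w.
  by rewrite !edotE (edotC w v); ring.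
by rewrite -/m -/b; nra.
Qed.

(* A minimiser of [enorm (G x - x)] is fixed, since [G] would otherwise map it to a
   point with a smaller value. *)
Lemma contraction_fixed_point (R : realType) (n : nat) (q : R)
    (G : 'rV[R]_n -> 'rV[R]_n) :
  q < 1 -> elipschitz q G -> exists x, G x = x.
Proof.
move=> q_lt1 G_lip.
have T_neq0 : [set: 'rV[R]_n] !=set0 by exists 0.
have [|c|z _ zmin] :=
  coercive_min (phi := fun x => enorm (G x - x)) T_neq0 closedT.
- move=> x.
  have Gx : G y - y @[y --> x] --> G x - x.
    exact: (cvgB (elipschitz_continuous G_lip (x := x)) cvg_id).
  exact: (cvg_comp _ _ Gx (@enorm_continuous R n (G x - x))).
(* From [|y| <= |G y| + |G y - y|] and [|G y| <= q |y| + |G 0|]. *)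
- exists ((c + enorm (G 0)) / (1 - q)) => y yc.
  rewrite ler_pdivlMr ?subr_gt0 //.
  have := G_lip y 0; rewrite subr0 => Gy0.
  have := enormD (G y - G 0) (G 0); rewrite subrK => Gy.
  have := enormD (G y) (- (G y - y)); rewrite subKr enormN => yle.
  lra.
have Gz := zmin (G z) I; have := G_lip (G z) z => GGz.
exists z; apply/eqP; rewrite -subr_eq0; apply/eqP/enorm_eq0/eqP.
by rewrite eq_le enorm_ge0 andbT; nra.
Qed.

(** * Contraction estimates: iterates and a single step *)

(** Only the distances to [z] are compared, so the map applied may change with [k], as the relaxed
    steps do. *)
Lemma contraction_iterates_cvg (R : realType) (n : nat) (q : R)
    (x : nat -> 'rV[R]_n) (z : 'rV[R]_n) :
  0 <= q < 1 -> (forall k, enorm (x k.+1 - z) <= q * enorm (x k - z)) ->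
  enorm (x k - z) @[k --> \oo] --> (0 : R).
Proof.
move=> /andP[q_ge0 q_lt1] x_contr.
have x_le k : 0 <= enorm (x k - z) <= geometric (enorm (x 0%N - z)) q k.
  rewrite enorm_ge0 /=; elim: k => [|k IH]; first by rewrite expr0 mulr1.
  by rewrite (le_trans (x_contr k)) // exprS mulrCA ler_wpM2l.
have geo := @cvg_geometric R (enorm (x 0%N - z)) q.
rewrite ger0_norm // in geo.
exact: (squeeze_cvgr (nearW _ x_le) (cvg_cst 0) (geo q_lt1)).
Qed.

(* [d], [e] and [p] are the increments of the point, of [f - s] and of the projected point
   between two arguments; the last hypothesis is the firm nonexpansiveness of the
   projection. *)
Lemma projection_step_le (R : realType) (n : nat) (d e p : 'rV[R]_n)
    (alpha gamma E A B lam : R) :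
  0 < alpha -> 0 < A -> A <= lam <= B -> B < 2 / alpha ->
  0 <= 2 * gamma - E / (alpha ^+ 2 * (2 / alpha - B)) ->
  gamma * edot d d <= edot e d -> edot e e <= E * edot d d ->
  0 <= edot p (e - alpha *: d - p) ->
  edot (d + lam *: (p - e)) (d + lam *: (p - e)) <=
    edot d d *
      (1 - A * (2 * gamma - E / (alpha ^+ 2 * (2 / alpha - B)))).
Proof.
move=> alpha_gt0 A_gt0 /andP[A_le B_ge] B_lt.
set rho := 2 / alpha - B; have rho_gt0 : 0 < rho by rewrite subr_gt0.
set delta := 2 * gamma - _ => delta_ge0 mono lip p_firm.
have lam_gt0 : 0 < lam by lra.
have dd_ge0 := edot_ge0 d.
(* The squared norm is [|d|^2] plus [lam] times this left side; as [delta] is nonnegative, [lam] may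
   then be lowered to [A]. *)
suff : lam * edot (p - e) (p - e) + 2 * edot d (p - e) <= - delta * edot d d.
  move=> bracket.
  rewrite [leLHS](_ : _ = edot d d +
    lam * (lam * edot (p - e) (p - e) + 2 * edot d (p - e))); last first.
    by rewrite !edotE (edotC p d) (edotC e d); ring.
  have : lam * (lam * edot (p - e) (p - e) + 2 * edot d (p - e)) <=
      lam * (- delta * edot d d) by rewrite ler_pM2l.
  have : A * (delta * edot d d) <= lam * (delta * edot d d).
    by rewrite ler_wpM2r // mulr_ge0.
  lra.
have lamTT : (lam - B) * edot (p - e) (p - e) <= 0.
  by rewrite mulr_le0_ge0 ?edot_ge0 // subr_le0.
(* Young's inequality with weight [rho], the margin by which [B] stays below [2 / alpha]. *)
have young_scaled : 0 <= rho * edot (p - e) (p - e) + 2 * alpha^-1 * edot (p - e) e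
    + alpha^-1 ^+ 2 * rho^-1 * edot e e.
  rewrite [leRHS](_ : _ = rho^-1 * edot (rho *: (p - e) + alpha^-1 *: e)
    (rho *: (p - e) + alpha^-1 *: e)); first by
    rewrite mulr_ge0 ?edot_ge0 // invr_ge0 ltW.
  by rewrite !edotE (edotC e p); field; rewrite !gt_eqF.
have lip_scaled : alpha^-1 ^+ 2 * rho^-1 * edot e e <=
    alpha^-1 ^+ 2 * rho^-1 * (E * edot d d).
  by rewrite ler_wpM2l // mulr_ge0 ?exprn_ge0 // invr_ge0 ltW.
have firm_scaled : 0 <= 2 * alpha^-1 * (edot p e - edot p p) - 2 * edot d p.
  rewrite [leRHS](_ : _ = 2 * alpha^-1 * edot p (e - alpha *: d - p)).
    by rewrite mulr_ge0 // mulr_ge0 // invr_ge0 ltW.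
  by rewrite !edotE (edotC p d); field; rewrite gt_eqF.
have -> : delta = 2 * gamma - alpha^-1 ^+ 2 * rho^-1 * E.
  by rewrite /delta; field; rewrite !gt_eqF.
(* Bound [lam] by [B = 2 / alpha - rho]. Firm nonexpansiveness gives [(2 / alpha) |p - e|^2 + 2 <d,
   p> <= - (2 / alpha) <p - e, e>], and Young's inequality absorbs this cross term into
   [- rho |p - e|^2]. *)
move: lamTT young_scaled; have -> : B = 2 * alpha^-1 - rho by rewrite /rho subKr.
move: mono firm_scaled; rewrite !edotE (edotC e d) (edotC e p).
lra.
Qed.

(** Distances are translation invariant, so [p] is the point of [Omega] nearest to [u - a]. *)
Lemma metric_proj_translate (R : realType) (n : nat) (Omega : set 'rV[R]_n)
    (a u : 'rV[R]_n) (p := metric_proj [set a + w | w in Omega] u - a) :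
  Omega !=set0 -> closed Omega -> convex_set Omega ->
  Omega p /\ forall w, Omega w -> edot (u - a - p) (w - p) <= 0.
Proof.
move=> Omega_neq0 Omega_closed Omega_convex.
have [q [Oq qmin]] := nearest_points_nonempty (u - a) Omega_neq0 Omega_closed.
have : nearest_points [set a + w | w in Omega] u (a + p).
  (* The witness [a + q] shows that the default value of [metric_proj] is not taken. *)
  rewrite /p addrC subrK /metric_proj; apply: xgetPex; exists (a + q).
  split=> [|_ [w Ow <-]]; first by exists q.
  by rewrite !opprD !addrA; exact: qmin.
move=> [[w Ow /addrI wp] pmin]; rewrite wp in Ow; split=> // v Ov.
apply: (nearest_points_edot_le0 Omega_convex) => //; split=> // y Oy.
by rewrite -!addrA -!opprD; apply: pmin; exists y.
Qed.

(** * Convergence to the unique solution of the inverse quasi-variational inequality *)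

Theorem theorem6p1 (R : realType) (n : nat)
    (f s : 'rV[R]_n -> 'rV[R]_n) (Phi : 'rV[R]_n -> set 'rV[R]_n)
    (Omega : set 'rV[R]_n) (L l beta alpha A B : R) (lambda : nat -> R)
    (f_mono : strongly_monotone beta f) (f_lip : elipschitz L f)
    (PhiE : forall x, Phi x = [set s x + w | w in Omega])
    (l_gt0 : 0 < l) (s_lip : elipschitz l s)
    (Omega_nonempty : Omega !=set0) (Omega_closed : closed Omega)
    (Omega_convex : convex_set Omega)
    (beta_gt : l < beta)
    (alpha_gt : (L ^+ 2 + l ^+ 2) / (2 * (beta - l)) < alpha)
    (lambda_bounds : forall k, [/\ 0 < A, A < lambda k & lambda k < B])
    (AB_gt0 : 0 < B ^+ 2 / A)
    (AB_lt : B ^+ 2 / A <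
       (2 * alpha * (beta - l) - (L ^+ 2 + l ^+ 2))
         / (alpha ^+ 2 * (beta - l))) :
  exists xstar : 'rV[R]_n,
    unique (iqvi_solution f Phi) xstar /\
    forall (x0 : 'rV[R]_n) (x : nat -> 'rV[R]_n),
      x 0%N = x0 ->
      (forall k, x k.+1 =
         x k + lambda k *: (metric_proj (Phi (x k)) (f (x k) - alpha *: x k)
                            - f (x k))) ->
      enorm (x k - xstar) @[k --> \oo] --> (0 : R).
Proof.
have [A_gt0 A_lt lam0_lt] := lambda_bounds 0%N.
have gamma_gt0 : 0 < beta - l by rewrite subr_gt0.
set S := L ^+ 2 + l ^+ 2 in alpha_gt AB_lt.
have S_gt0 : 0 < S by have := sqr_ge0 L; rewrite /S; nra.
have alpha_gt0 : 0 < alpha.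
  by apply: lt_trans alpha_gt; rewrite divr_gt0 // mulr_gt0.
(* The upper bound on [B ^+ 2 / A] is [2 / alpha - S / (alpha ^+ 2 * (beta - l))]. *)
have rho_gt : S / (alpha ^+ 2 * (beta - l)) < 2 / alpha - B.
  have B_lt : B < B ^+ 2 / A by rewrite ltr_pdivlMr // expr2 ltr_pM2l; lra.
  have -> : S / (alpha ^+ 2 * (beta - l)) =
      2 / alpha - (2 * alpha * (beta - l) - S) / (alpha ^+ 2 * (beta - l)).
    by field; rewrite !gt_eqF.
  lra.
have aag_gt0 : 0 < alpha ^+ 2 * (beta - l) by rewrite mulr_gt0 ?exprn_gt0.
have rho_gt0 : 0 < 2 / alpha - B by apply: lt_trans rho_gt; rewrite divr_gt0.
(* The constant of [projection_step_le] for [gamma = beta - l] and [E = 2 * S]; [rho_gt] is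
   equivalent to its positivity. *)
set delta := 2 * (beta - l) - 2 * S / (alpha ^+ 2 * (2 / alpha - B)).
have delta_gt0 : 0 < delta.
  have aar_gt0 : 0 < alpha ^+ 2 * (2 / alpha - B) by rewrite mulr_gt0 ?exprn_gt0.
  rewrite subr_gt0 -mulrA ltr_pM2l // ltr_pdivrMr //.
  by move: rho_gt; rewrite ltr_pdivrMr //; lra.
(* [1 - A * delta] may be negative a priori; [Num.sqrt] is then [0]. *)
pose q := Num.sqrt (1 - A * delta).
have q01 : 0 <= q < 1.
  rewrite sqrtr_ge0 /= -[ltRHS]sqrtr1 ltr_sqrt //.
  by have := mulr_gt0 A_gt0 delta_gt0; lra.
pose h x := f x - s x.
pose P x := metric_proj (Phi x) (f x - alpha *: x) - s x.
have P_proj x : Omega (P x) /\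
    forall w, Omega w -> edot (h x - alpha *: x - P x) (w - P x) <= 0.
  have := metric_proj_translate (s x) (f x - alpha *: x) Omega_nonempty
    Omega_closed Omega_convex.
  by rewrite -PhiE (addrAC (f x)).
have hB x y : h x - h y = (f x - f y) - (s x - s y).
  by rewrite /h !opprD !opprK addrACA.
have h_mono x y : (beta - l) * edot (x - y) (x - y) <= edot (h x - h y) (x - y).
  have := f_mono.2 x y; have := edot_le (s x - s y) (x - y).
  have := ler_wpM2r (enorm_ge0 (x - y)) (s_lip x y).
  rewrite hB (edotDl (f x - f y)) edotNl -!sqr_enorm; lra.
have h_lip x y :
    edot (h x - h y) (h x - h y) <= 2 * S * edot (x - y) (x - y).
  have := elipschitz_sqr x y f_lip; have := elipschitz_sqr x y s_lip.
  (* This square yields [|v - w|^2 <= 2 |v|^2 + 2 |w|^2]. *)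
  have := edot_ge0 ((f x - f y) + (s x - s y)).
  rewrite hB; move: (f x - f y) (s x - s y) => v w.
  by rewrite !edotE (edotC w v) /S; lra.
have step_lip lam : A < lam < B ->
    elipschitz q (fun x =>
      x + lam *: (metric_proj (Phi x) (f x - alpha *: x) - f x)).
  move=> /andP[lamA lamB] x y.
  rewrite /q [leRHS]mulrC /enorm -sqrtrM ?edot_ge0 // ler_wsqrtr //.
  have TE z : metric_proj (Phi z) (f z - alpha *: z) - f z = P z - h z.
    by rewrite /P /h opprB addrA subrK.
  have -> : x + lam *: (metric_proj (Phi x) (f x - alpha *: x) - f x) -
      (y + lam *: (metric_proj (Phi y) (f y - alpha *: y) - f y)) =
      (x - y) + lam *: ((P x - P y) - (h x - h y)).
    rewrite !TE (opprD y) addrACA -scalerBr; congr (_ + _ *: _).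
    by rewrite !opprD !opprK addrACA.
  apply: projection_step_le => //; try exact: ltW.
  - by rewrite !ltW.
  - by rewrite -subr_gt0.
  (* Firm nonexpansiveness: test the inequality at each projected point with the other one, and
     add. *)
  have [Ox xle] := P_proj x; have [Oy yle] := P_proj y.
  have := xle _ Oy; have := yle _ Ox.
  have -> : h x - h y - alpha *: (x - y) - (P x - P y) =
      (h x - alpha *: x - P x) - (h y - alpha *: y - P y).
    move: (h x) (h y) (P x) (P y) => hx hy px py.
    by rewrite scalerBr !opprD (addrACA hx) (addrACA (hx - _)).
  move: (P x) (P y) (h x - _ - _) (h y - _ - _) => px py u v.
  rewrite -(opprB px py) (edotC _ (u - v)) edotDl edotNl edotNr.
  lra.
have shift x w : s x + w - f x = w - h x by rewrite /h opprB addrCA addrA.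
have fixed_sol x :
    metric_proj (Phi x) (f x - alpha *: x) = f x -> iqvi_solution f Phi x.
  move=> projE; have [] := P_proj x.
  rewrite /P projE -/(h x) => Oh hle; rewrite /iqvi_solution PhiE; split.
    by exists (h x) => //; rewrite addrC subrK.
  move=> _ [w Ow <-]; have := hle w Ow.
  (* Here [P x = h x], so the projected vector minus its projection is [- alpha *: x]. *)
  rewrite addrAC subrr add0r edotNl edotZl oppr_le0 pmulr_rge0 //.
  by rewrite shift.
have sol_uniq x y : iqvi_solution f Phi x -> iqvi_solution f Phi y -> x = y.
  move=> [+ xle] [+ yle]; rewrite !PhiE => -[v Ov vE] [w Ow wE].
  have vh : v = h x by rewrite /h -vE addrAC subrr add0r.
  have wh : w = h y by rewrite /h -wE addrAC subrr add0r.
  (* Each solution is tested with the point of [Omega] belonging to the other; the sum gives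
     [<h x - h y, x - y> <= 0], against strong monotonicity. *)
  have := xle (s x + w); rewrite PhiE => /(_ (ex_intro2 _ _ w Ow erefl)).
  have := yle (s y + v); rewrite PhiE => /(_ (ex_intro2 _ _ v Ov erefl)).
  rewrite !shift vh wh.
  have := h_mono x y; move: (h x) (h y) => hx hy.
  rewrite -(opprB hx hy) edotNr (edotC (hx - hy)) (edotDl _ _ (hx - hy)) (edotNl y).
  move=> hxy ylt xlt.
  apply/eqP; rewrite -subr_eq0; apply/eqP/edot_eq0/eqP.
  rewrite eq_le edot_ge0 andbT -(ler_pM2l gamma_gt0) mulr0; lra.
have lam_in k : A < lambda k < B by have [_ -> ->] := lambda_bounds k.
(* The fixed point is taken for [lambda 0]; since [lambda 0] is nonzero its bracket vanishes, so
   every other step fixes it too. *)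
have [xstar xstarE] :=
  contraction_fixed_point (andP q01).2 (step_lip _ (lam_in 0%N)).
have projE : metric_proj (Phi xstar) (f xstar - alpha *: xstar) = f xstar.
  move: xstarE => /(canRL (addKr _)); rewrite addNr => /eqP.
  rewrite scaler_eq0 gt_eqF /=; last exact: lt_trans A_lt.
  by rewrite subr_eq0 => /eqP.
exists xstar; split.
  split=> [|y]; first exact: fixed_sol.
  by apply: sol_uniq; exact: fixed_sol.
move=> _ x _ xS; apply: contraction_iterates_cvg q01 _ => k.
have := step_lip _ (lam_in k) (x k) xstar.
by rewrite /= projE subrr scaler0 addr0 -xS.
Qed.
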